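(* For all integers $r$, $s$ and $n\ge 0$: \begin{align*} \Delta\sum_{i=0}^{n}U_{r+2i}U_{s+2i}&=a_{n+1}V_{2n+r+s}-(n+1)q^{r}V_{s-r},\\ \sum_{i=0}^{n}V_{r+2i}V_{s+2i}&=a_{n+1}V_{2n+r+s}+(n+1)q^{r}V_{s-r},\\ \sum_{i=0}^{n}U_{r+2i}V_{s+2i}&=a_{n+1}U_{2n+r+s}-(n+1)q^{r}U_{s-r},\\ \Delta\sum_{i=0}^{n}(-1)^iU_{r+2i}U_{s+2i}&=\begin{cases}d_{m}V_{4m+r+s}-q^{r}V_{s-r}&\text{if }n=2m,\\-p\Delta c_{m}U_{4m+r+s+2}&\text{if }n=2m+1,\end{cases}\\ \sum_{i=0}^{n}(-1)^iV_{r+2i}V_{s+2i}&=\begin{cases}d_{m}V_{4m+r+s}+q^{r}V_{s-r}&\text{if }n=2m,\\-p\Delta c_{m}U_{4m+r+s+2}&\text{if }n=2m+1,\end{cases}\\ \sum_{i=0}^{n}(-1)^iU_{r+2i}V_{s+2i}&=\begin{cases}d_{m}U_{4m+r+s}-q^{r}U_{s-r}&\text{if }n=2m,\\-pc_{m}V_{4m+r+s+2}&\text{if }n=2m+1,\end{cases} \end{align*} where in the last three identities $m\ge 0$ is the integer determined by $n=2m$ or $n=2m+1$.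
   Context: Let $p,q$ be integers with $p\neq 0$, $q\in\{1,-1\}$, and $\Delta:=p^2-4q\neq 0$. The sequences $(U_n)_{n\in\mathbb{Z}}$ and $(V_n)_{n\in\mathbb{Z}}$ are defined by $U_0=0$, $U_1=1$, $V_0=2$, $V_1=p$ and the recurrences $U_n=pU_{n-1}-qU_{n-2}$, $V_n=pV_{n-1}-qV_{n-2}$ for all $n\in\mathbb{Z}$ (so they are extended to negative indices by the recurrence). Under these assumptions $U_2$, $V_2$ and $U_4$ are nonzero. For $n\in\mathbb{Z}$ define $$a_n=\frac{U_{2n}}{U_2},\qquad c_n=\frac{U_{4n+4}}{U_4},\qquad d_n=\frac{V_{4n+2}}{V_2}.$$ *)

(* Defs.v *)
From mathcomp Require Import all_boot all_order all_algebra.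

Set Implicit Arguments.
Unset Strict Implicit.
Unset Printing Implicit Defensive.

Import Order.TTheory GRing.Theory Num.Theory.
Local Open Scope ring_scope.

Definition lucas_rec (p q : int) (W : int -> int) : Prop :=
  forall n : int, W n = p * W (n - 1) - q * W (n - 2).

(* When q is 1 or -1 the recurrence also determines W at negative indices, so
   each of the two predicates below holds for exactly one W up to pointwise
   equality; see [lucasU_exists] and [lucasV_exists] for existence. *)
Definition is_lucasU (p q : int) (U : int -> int) : Prop :=
  [/\ U 0 = 0, U 1 = 1 & lucas_rec p q U].

Definition is_lucasV (p q : int) (V : int -> int) : Prop :=
  [/\ V 0 = 2, V 1 = p & lucas_rec p q V].

Definition discr (p q : int) : int := p ^+ 2 - 4 * q.

(* The quotients are taken in rat, so that no integer rounding is involved. *)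
Definition a_ (U : int -> int) (n : int) : rat := (U (2 * n))%:Q / (U 2)%:Q.

Definition c_ (U : int -> int) (n : int) : rat := (U (4 * n + 4))%:Q / (U 4)%:Q.

Definition d_ (V : int -> int) (n : int) : rat := (V (4 * n + 2))%:Q / (V 2)%:Q.

Fixpoint lucas_nat (p q x y : int) (n : nat) : int :=
  if n is n'.+1 then lucas_nat p q y (p * y - q * x) n' else x.

Definition lucas_int (p q x y : int) (n : int) : int :=
  match n with
  | Posz k => lucas_nat p q x y k
  | Negz k => lucas_nat (p * q) q x (q * (p * x - y)) k.+1
  end.

Lemma lucas_natSS p q x y n :
  lucas_nat p q x y n.+2
  = p * lucas_nat p q x y n.+1 - q * lucas_nat p q x y n.
Proof. by elim: n x y => [|n IHn] x y //; rewrite -IHn. Qed.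

Lemma lucas_int_rec p q x y : q = 1 \/ q = -1 -> lucas_rec p q (lucas_int p q x y).
Proof.
move=> hq; have qq : q * q = 1 by case: hq => ->.
have back u v w : w = p * q * v - q * u -> u = p * v - q * w.
  by move=> ->; rewrite [p * q]mulrC -mulrA -mulrBr mulrA qq mul1r subKr.
case=> [[|[|k]]|k].
- by apply: back; exact: (lucas_natSS _ _ _ _ 0).
- by rewrite /= mulrA qq mul1r subKr.
- rewrite (_ : k.+2%:Z - 1 = k.+1%:Z); last by rewrite -addn1 PoszD addrK.
  rewrite (_ : k.+2%:Z - 2 = k%:Z); last by rewrite -addn2 PoszD addrK.
  exact: lucas_natSS.
- rewrite (_ : Negz k - 1 = Negz k.+1); last by rewrite !NegzE -opprD -PoszD addn1.
  rewrite (_ : Negz k - 2 = Negz k.+2); last by rewrite !NegzE -opprD -PoszD addn2.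
  by apply: back; exact: lucas_natSS.
Qed.

Lemma lucasU_exists p q : q = 1 \/ q = -1 -> exists U, is_lucasU p q U.
Proof. by move=> hq; exists (lucas_int p q 0 1); split=> //; apply: lucas_int_rec. Qed.

Lemma lucasV_exists p q : q = 1 \/ q = -1 -> exists V, is_lucasV p q V.
Proof. by move=> hq; exists (lucas_int p q 2 p); split=> //; apply: lucas_int_rec. Qed.

(* Main.v *)
Require Import Defs.
From mathcomp Require Import all_boot all_order all_algebra.
From mathcomp Require Import zify ring.

Set Implicit Arguments.
Unset Strict Implicit.
Unset Printing Implicit Defensive.

Import Order.TTheory GRing.Theory Num.Theory.
Local Open Scope ring_scope.


(** For every solution [W] of the recurrence, put [W' y = W (y + 1) - q W (y - 1)].
Two product rules drive everything:
- [V x * W y = W (x + y) + q^x W (y - x)] ([mulV_recurrent]),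
- [U x * W' y = W (x + y) - q^x W (y - x)] ([mulU_companion]).
In each, both sides solve the recurrence as functions of [x], so it is enough
to compare them at [x = 0] and [x = 1] ([recurrent_eq]).  Since [U' = V] and
[V' = Delta U], the rules contain the product formulas for [UU], [VV] and [UV].

These formulas turn a product [f (r + 2i) (s + 2i)] into a term
[C (r + s + 4i)] plus a term [q^(r + 2i) C (s - r)] that does not depend on [i],
because [q^2 = 1] ([sum_product]).  There remain linear sums with step 4, which
telescope: the rules at [x = 2] read
[U 2 * W' y = W (y + 2) - W (y - 2)] and [V 2 * W y = W (y + 2) + W (y - 2)],
the first one being suited to the plain sum and the second one to the
alternating sum.  The two boundary terms left by the telescoping are folded back
into a single product by the same rules, read from right to left with an even
[x].  In the alternating sum the sign of the last boundary term decides which of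
the two rules applies, whence the two cases according to the parity of [n].

The plain sum is obtained this way for sequences of the form [W'] only; it holds
for every solution because [W'' = Delta W] and [Delta] is nonzero. *)

(** * Two-sided solutions of the recurrence *)

Definition recurrent (F : fieldType) (p q : F) (W : int -> F) : Prop :=
  forall n : int, W n = p * W (n - 1) - q * W (n - 2).

(** If [W n = A a^n + B b^n] with [a], [b] the roots of [X^2 - p X + q], then the
companion is [(a - b) (A a^n - B b^n)]; this exchanges the two Lucas sequences
up to the factor [(a - b)^2 = p^2 - 4 q]. *)
Definition companion (F : fieldType) (q : F) (W : int -> F) (n : int) : F :=
  W (n + 1) - q * W (n - 1).

Definition lucas_pair (F : fieldType) (p q : F) (U V : int -> F) : Prop :=
  [/\ U 0 = 0, U 1 = 1, V 0 = 2, V 1 = p & recurrent p q U /\ recurrent p q V].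

Lemma recurrent_at (F : fieldType) (p q : F) (W : int -> F) (a b c : int) :
  recurrent p q W -> b = a - 1 -> c = a - 2 -> W a = p * W b - q * W c.
Proof. by move=> hW -> ->; exact: hW. Qed.

(** Invertibility of [q] lets the recurrence run backwards, so two consecutive
values determine a solution at negative indices too. *)
Lemma recurrent_eq (F : fieldType) (p q : F) (W W' : int -> F) :
    q != 0 -> recurrent p q W -> recurrent p q W' ->
  W 0 = W' 0 -> W 1 = W' 1 -> W =1 W'.
Proof.
move=> q0 hW hW' e0 e1.
have fwd n : W n = W' n -> W (n + 1) = W' (n + 1) ->
    W (n + 1 + 1) = W' (n + 1 + 1).
  move=> h0 h1; rewrite hW hW'.
  have -> : n + 1 + 1 - 1 = n + 1 by lia.
  have -> : n + 1 + 1 - 2 = n by lia.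
  by rewrite h0 h1.
have bwd n : W n = W' n -> W (n - 1) = W' (n - 1) -> W (n - 2) = W' (n - 2).
  move=> h0 h1; apply: (mulfI q0).
  by move: (hW n) (hW' n); rewrite h0 h1 => -> /addrI/oppr_inj.
have up (n : nat) : W n%:Z = W' n%:Z /\ W (n%:Z + 1) = W' (n%:Z + 1).
  elim: n => [|n [IH0 IH1]]; first by rewrite add0r.
  have -> : n.+1%:Z = n%:Z + 1 by lia.
  by split; [exact: IH1 | exact: fwd].
have down (n : nat) : W (- n%:Z) = W' (- n%:Z) /\ W (1 - n%:Z) = W' (1 - n%:Z).
  elim: n => [|n [IH0 IH1]]; first by rewrite oppr0 addr0.
  have e1n : 1 - n.+1%:Z = - n%:Z by lia.
  have e2n : - n.+1%:Z = 1 - n%:Z - 2 by lia.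
  rewrite e1n e2n; split; last exact: IH0.
  apply: bwd; first exact: IH1.
  by have -> : 1 - n%:Z - 1 = - n%:Z by lia.
by case=> n; [case: (up n) | rewrite NegzE; case: (down n.+1)].
Qed.

Lemma recurrent_shift (F : fieldType) (p q : F) (W : int -> F) (k : int) :
  recurrent p q W -> recurrent p q (fun n => W (n + k)).
Proof. by move=> hW n; apply: recurrent_at hW _ _; lia. Qed.

Lemma recurrent_scale (F : fieldType) (p q c : F) (W : int -> F) :
  recurrent p q W -> recurrent p q (fun n => c * W n).
Proof. by move=> hW n; rewrite [in LHS]hW; ring. Qed.

Lemma recurrent_add (F : fieldType) (p q : F) (W W' : int -> F) :
    recurrent p q W -> recurrent p q W' ->
  recurrent p q (fun n => W n + W' n).
Proof. by move=> hW hW' n; rewrite [in LHS]hW [in LHS]hW'; ring. Qed.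

Lemma recurrent_companion (F : fieldType) (p q : F) (W : int -> F) :
  recurrent p q W -> recurrent p q (companion q W).
Proof.
move=> hW n; rewrite /companion.
rewrite (@recurrent_at _ p q W (n + 1) (n - 1 + 1) (n - 2 + 1)) //; try lia.
rewrite (@recurrent_at _ p q W (n - 1) (n - 1 - 1) (n - 2 - 1)) //; try lia.
ring.
Qed.

(** The roots of the characteristic polynomial have product [q], so
[x |-> q^x W (- x)] exchanges the two geometric components of [W]. *)
Lemma recurrent_reflect (F : fieldType) (p q : F) (W : int -> F) (y : int) :
  q != 0 -> recurrent p q W -> recurrent p q (fun x => q ^ x * W (y - x)).
Proof.
move=> q0 hW x.
have q1 : q ^ (x - 1) = q * q ^ (x - 2).
  by rewrite -[q in q * _]expr1z -expfzDr //; congr (q ^ _); lia.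
have q2 : q ^ x = q * (q * q ^ (x - 2)).
  by rewrite -q1 -[q in q * _]expr1z -expfzDr //; congr (q ^ _); lia.
rewrite q2 q1.
rewrite (@recurrent_at _ p q W (y - (x - 2)) (y - (x - 1)) (y - x)) //; try lia.
ring.
Qed.

(** * Product rules *)

Lemma mulV_recurrent (F : fieldType) (p q : F) (U V W : int -> F) (x y : int) :
    q != 0 -> lucas_pair p q U V -> recurrent p q W ->
  V x * W y = W (x + y) + q ^ x * W (y - x).
Proof.
move=> q0 [_ _ V0 V1 [_ hV]] hW; rewrite mulrC; move: x.
apply: (@recurrent_eq _ p q) => //.
- exact: recurrent_scale.
- by apply: recurrent_add; [apply: recurrent_shift | apply: recurrent_reflect].
- by rewrite V0 add0r subr0 expr0z; ring.
- rewrite V1 expr1z (@recurrent_at _ p q W (1 + y) y (y - 1)) //; try lia.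
  ring.
Qed.

Lemma mulU_companion (F : fieldType) (p q : F) (U V W : int -> F) (x y : int) :
    q != 0 -> lucas_pair p q U V -> recurrent p q W ->
  U x * companion q W y = W (x + y) - q ^ x * W (y - x).
Proof.
move=> q0 [U0 U1 _ _ [hU _]] hW; rewrite mulrC -mulN1r; move: x.
apply: (@recurrent_eq _ p q) => //.
- exact: recurrent_scale.
- apply: recurrent_add; first exact: recurrent_shift.
  by apply: recurrent_scale; apply: recurrent_reflect.
- by rewrite U0 add0r subr0 expr0z; ring.
- by rewrite U1 expr1z /companion [1 + y]addrC; ring.
Qed.

(** * Companions of the Lucas sequences *)

Lemma companionU (F : fieldType) (p q : F) (U V : int -> F) :
  q != 0 -> lucas_pair p q U V -> companion q U =1 V.
Proof.
move=> q0 [U0 U1 V0 V1 [hU hV]].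
apply: (@recurrent_eq _ p q) => //; first exact: recurrent_companion.
- have := @recurrent_at _ p q U 1 0 (- 1) hU erefl erefl.
  rewrite /companion add0r sub0r V0 U0 U1 => h.
  by rewrite -[q * _](subKr (p * 0)) -h; ring.
- have := @recurrent_at _ p q U 2 1 0 hU erefl erefl.
  by rewrite /companion subrr V1 U0 U1 => -> ; ring.
Qed.

(** This is what allows a formula proved for companions only to be transferred to
all solutions when the discriminant is nonzero. *)
Lemma companion2 (F : fieldType) (p q : F) (W : int -> F) (y : int) :
    recurrent p q W ->
  companion q (companion q W) y = (p ^+ 2 - 4 * q) * W y.
Proof.
move=> hW; rewrite /companion addrK subrK.
rewrite (@recurrent_at _ p q W (y + 1 + 1) (y + 1) y) //; try lia.
rewrite (@recurrent_at _ p q W (y + 1) y (y - 1)) //; try lia.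
have := @recurrent_at _ p q W y (y - 1) (y - 1 - 1) hW.
move=> ->; try lia; ring.
Qed.

Lemma companionV (F : fieldType) (p q : F) (U V : int -> F) (y : int) :
    q != 0 -> lucas_pair p q U V ->
  companion q V y = (p ^+ 2 - 4 * q) * U y.
Proof.
move=> q0 hL; have [_ _ _ _ [hU _]] := hL.
by rewrite -(companion2 _ hU) /companion -!(companionU q0 hL).
Qed.

(** * Telescoping sums with step 4 *)

Lemma expz_even (F : fieldType) (q : F) (k : int) :
  q ^+ 2 = 1 -> q ^ (2 * k) = 1.
Proof. by move=> q2; rewrite -exprz_exp -exprnP q2 exp1rz. Qed.

Lemma sqr1_neq0 (F : fieldType) (q : F) : q ^+ 2 = 1 -> q != 0.
Proof. by move=> q2; rewrite -sqrf_eq0 q2 oner_neq0. Qed.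

Lemma sum_companion_step4 (F : fieldType) (p q : F) (U V W : int -> F)
    (t : int) (n : nat) :
    q ^+ 2 = 1 -> lucas_pair p q U V -> recurrent p q W ->
  U 2 * (\sum_(0 <= i < n.+1) companion q W (t + 4 * i%:Z))
    = W (t + 4 * n%:Z + 2) - W (t - 2).
Proof.
move=> q2 hL hW; have q0 := sqr1_neq0 q2.
have step y : U 2 * companion q W y = W (y + 2) - W (y - 2).
  by rewrite (mulU_companion _ _ q0 hL hW) [2 + y]addrC -exprnP q2 mul1r.
elim: n => [|n IH]; first by rewrite big_nat1 step mulr0 addr0.
rewrite big_nat_recr //= mulrDr IH step.
have -> : t + 4 * n.+1%:Z - 2 = t + 4 * n%:Z + 2 by lia.
ring.
Qed.

Lemma alt_sum_step4 (F : fieldType) (p q : F) (U V W : int -> F)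
    (t : int) (n : nat) :
    q ^+ 2 = 1 -> lucas_pair p q U V -> recurrent p q W ->
  V 2 * (\sum_(0 <= i < n.+1) (-1) ^+ i * W (t + 4 * i%:Z))
    = W (t - 2) + (-1) ^+ n * W (t + 4 * n%:Z + 2).
Proof.
move=> q2 hL hW; have q0 := sqr1_neq0 q2.
have step y : V 2 * W y = W (y + 2) + W (y - 2).
  by rewrite (mulV_recurrent _ _ q0 hL hW) [2 + y]addrC -exprnP q2 mul1r.
elim: n => [|n IH].
  by rewrite big_nat1 expr0 !mul1r step mulr0 addr0 addrC.
rewrite big_nat_recr //= mulrDr IH mulrCA step exprS.
have -> : t + 4 * n.+1%:Z - 2 = t + 4 * n%:Z + 2 by lia.
ring.
Qed.

(** The telescoped form applies to companions; here it is applied to the companion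
of the companion of [W], which is [W] up to the discriminant. *)
Lemma sum_step4 (F : fieldType) (p q : F) (U V W : int -> F)
    (t : int) (n : nat) :
    q ^+ 2 = 1 -> p ^+ 2 - 4 * q != 0 -> U 2 != 0 ->
    lucas_pair p q U V -> recurrent p q W ->
  \sum_(0 <= i < n.+1) W (t + 4 * i%:Z)
    = U (2 * (n%:Z + 1)) / U 2 * W (2 * n%:Z + t).
Proof.
move=> q2 D0 U20 hL hW; have q0 := sqr1_neq0 q2.
have hW' := recurrent_companion hW.
apply: (mulfI D0); apply: (mulfI U20).
transitivity (U (2 * (n%:Z + 1)) * companion q (companion q W) (2 * n%:Z + t)).
  rewrite (mulU_companion _ _ q0 hL hW') expz_even // mul1r mulr_sumr.
  under eq_bigr do rewrite -(companion2 _ hW).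
  rewrite (sum_companion_step4 _ _ q2 hL hW').
  by congr (companion _ _ _ - companion _ _ _); lia.
by rewrite (companion2 _ hW); field.
Qed.

(** After an even number of sign changes both boundary terms carry the sign [+],
which is the shape of the [V]-product rule with [x = 4 m + 2]. *)
Lemma alt_sum_step4_even (F : fieldType) (p q : F) (U V W : int -> F)
    (t : int) (m : nat) :
    q ^+ 2 = 1 -> V 2 != 0 -> lucas_pair p q U V -> recurrent p q W ->
  \sum_(0 <= i < (2 * m).+1) (-1) ^+ i * W (t + 4 * i%:Z)
    = V (4 * m%:Z + 2) / V 2 * W (4 * m%:Z + t).
Proof.
move=> q2 V20 hL hW; have q0 := sqr1_neq0 q2.
apply: (mulfI V20); rewrite (alt_sum_step4 _ _ q2 hL hW).
rewrite mulrA [V 2 * _]mulrC divfK // (mulV_recurrent _ _ q0 hL hW).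
have -> : 4 * m%:Z + 2 = 2 * (2 * m%:Z + 1) by lia.
rewrite expz_even // mul1r exprM sqrrN expr1n expr1n mul1r addrC.
by congr (W _ + W _); lia.
Qed.

(** The boundary terms now carry opposite signs, which is the shape of the
[U]-product rule with [x = 4 m + 4]; the factor [p] comes from
[U 4 = U 2 * V 2 = p * V 2]. *)
Lemma alt_sum_step4_odd (F : fieldType) (p q : F) (U V W : int -> F)
    (t : int) (m : nat) :
    q ^+ 2 = 1 -> p != 0 -> V 2 != 0 -> lucas_pair p q U V ->
    recurrent p q W ->
  \sum_(0 <= i < (2 * m + 1).+1) (-1) ^+ i * W (t + 4 * i%:Z)
    = - p * (U (4 * m%:Z + 4) / U 4) * companion q W (4 * m%:Z + t + 2).
Proof.
move=> q2 p0 V20 hL hW; have q0 := sqr1_neq0 q2.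
have [U0 U1 V0 V1 [hU hV]] := hL.
have U4 : U 4 = p * V 2.
  rewrite -(companionU q0 hL) (_ : p = U 2).
    rewrite (mulU_companion _ _ q0 hL hU).
    by rewrite (_ : (2 - 2)%R = 0) // U0 mulr0 subr0.
  have := @recurrent_at _ p q U 2 1 0 hU erefl erefl.
  by move=> ->; rewrite U0 U1; ring.
apply: (mulfI V20); rewrite (alt_sum_step4 _ _ q2 hL hW) U4.
transitivity (- (U (4 * m%:Z + 4) * companion q W (4 * m%:Z + t + 2))).
  rewrite (mulU_companion _ _ q0 hL hW).
  rewrite (_ : 4 * m%:Z + 4 = 2 * (2 * m%:Z + 2)); last by lia.
  rewrite expz_even // mul1r exprD exprM sqrrN expr1n expr1n mul1r opprB.
  rewrite mulN1r; congr (W _ - W _); lia.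
by field; rewrite p0 V20.
Qed.

(** * Sums of products *)

(** A product formula for [f] separates, along the progressions of step 2, a part
depending on the sum of the indices from a part constant in [i]: their
difference stays [s - r] and [q^(r + 2 i) = q^r]. The weights [e] are
[1] or [(-1)^i] in the applications. *)
Lemma sum_product (F : fieldType) (q eps : F) (f : int -> int -> F)
    (C : int -> F) (e : nat -> F) (r s : int) (n : nat) :
    q ^+ 2 = 1 ->
    (forall x y, f x y = C (x + y) + eps * (q ^ x * C (y - x))) ->
  \sum_(0 <= i < n) e i * f (r + 2 * i%:Z) (s + 2 * i%:Z)
    = \sum_(0 <= i < n) e i * C (r + s + 4 * i%:Z)
      + eps * (\sum_(0 <= i < n) e i) * (q ^ r * C (s - r)).
Proof.
move=> q2 hf; have q0 := sqr1_neq0 q2.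
rewrite mulr_sumr mulr_suml -big_split /=; apply: eq_bigr => i _.
rewrite hf expfzDr // expz_even // mulr1.
have -> : r + 2 * i%:Z + (s + 2 * i%:Z) = r + s + 4 * i%:Z by lia.
have -> : s + 2 * i%:Z - (r + 2 * i%:Z) = s - r by lia.
ring.
Qed.

Lemma sum_signs (F : fieldType) (n : nat) :
  \sum_(0 <= i < n.+1) (-1) ^+ i = (~~ odd n)%:R :> F.
Proof.
elim: n => [|n IH]; first by rewrite big_nat1.
rewrite big_nat_recr //= IH -signr_odd /=.
by case: (odd n); rewrite /= ?expr0 ?expr1 ?add0r ?subrr.
Qed.

(** [V 2 = p^2 - 2 q], and neither [2] nor [-2] is a square. *)
Lemma lucas_V2_neq0 (p q : int) : q = 1 \/ q = -1 -> p ^+ 2 - 2 * q != 0.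
Proof.
move=> hq; apply/eqP => /subr0_eq; rewrite expr2 => h.
have : p <= -2 \/ p = -1 \/ p = 0 \/ p = 1 \/ 2 <= p by lia.
by case: hq h => -> h [|[|[|[|]]]] hp; nia.
Qed.

Theorem corollary2 (p q : int) (U V : int -> int)
    (hp : p != 0) (hq : q = 1 \/ q = -1) (hD : discr p q != 0)
    (hU : is_lucasU p q U) (hV : is_lucasV p q V)
    (r s : int) (n : nat) :
  ((discr p q)%:Q * (\sum_(0 <= i < n.+1) (U (r + 2 * i%:Z))%:Q * (U (s + 2 * i%:Z))%:Q)
     = a_ U (n%:Z + 1) * (V (2 * n%:Z + r + s))%:Q - (n%:R + 1) * q%:Q ^ r * (V (s - r))%:Q)
  /\
  (\sum_(0 <= i < n.+1) (V (r + 2 * i%:Z))%:Q * (V (s + 2 * i%:Z))%:Q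
     = a_ U (n%:Z + 1) * (V (2 * n%:Z + r + s))%:Q + (n%:R + 1) * q%:Q ^ r * (V (s - r))%:Q)
  /\
  (\sum_(0 <= i < n.+1) (U (r + 2 * i%:Z))%:Q * (V (s + 2 * i%:Z))%:Q
     = a_ U (n%:Z + 1) * (U (2 * n%:Z + r + s))%:Q - (n%:R + 1) * q%:Q ^ r * (U (s - r))%:Q)
  /\
  (forall m : nat,
    (n = (2 * m)%N ->
     (discr p q)%:Q
       * (\sum_(0 <= i < n.+1) (-1) ^+ i * (U (r + 2 * i%:Z))%:Q * (U (s + 2 * i%:Z))%:Q)
     = d_ V m%:Z * (V (4 * m%:Z + r + s))%:Q - q%:Q ^ r * (V (s - r))%:Q)
    /\
    (n = (2 * m + 1)%N ->
     (discr p q)%:Q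
       * (\sum_(0 <= i < n.+1) (-1) ^+ i * (U (r + 2 * i%:Z))%:Q * (U (s + 2 * i%:Z))%:Q)
     = - p%:Q * (discr p q)%:Q * c_ U m%:Z * (U (4 * m%:Z + r + s + 2))%:Q))
  /\
  (forall m : nat,
    (n = (2 * m)%N ->
     \sum_(0 <= i < n.+1) (-1) ^+ i * (V (r + 2 * i%:Z))%:Q * (V (s + 2 * i%:Z))%:Q
     = d_ V m%:Z * (V (4 * m%:Z + r + s))%:Q + q%:Q ^ r * (V (s - r))%:Q)
    /\
    (n = (2 * m + 1)%N ->
     \sum_(0 <= i < n.+1) (-1) ^+ i * (V (r + 2 * i%:Z))%:Q * (V (s + 2 * i%:Z))%:Q
     = - p%:Q * (discr p q)%:Q * c_ U m%:Z * (U (4 * m%:Z + r + s + 2))%:Q))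
  /\
  (forall m : nat,
    (n = (2 * m)%N ->
     \sum_(0 <= i < n.+1) (-1) ^+ i * (U (r + 2 * i%:Z))%:Q * (V (s + 2 * i%:Z))%:Q
     = d_ V m%:Z * (U (4 * m%:Z + r + s))%:Q - q%:Q ^ r * (U (s - r))%:Q)
    /\
    (n = (2 * m + 1)%N ->
     \sum_(0 <= i < n.+1) (-1) ^+ i * (U (r + 2 * i%:Z))%:Q * (V (s + 2 * i%:Z))%:Q
     = - p%:Q * c_ U m%:Z * (V (4 * m%:Z + r + s + 2))%:Q)).

Proof.
have q2 : q%:Q ^+ 2 = 1 by case: hq => ->.
have p0 : p%:Q != 0 by rewrite intr_eq0.
have discrQ : (discr p q)%:Q = p%:Q ^+ 2 - 4 * q%:Q.
  by rewrite /discr rmorphB rmorphXn rmorphM.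
have D0 : p%:Q ^+ 2 - 4 * q%:Q != 0 by rewrite -discrQ intr_eq0.
pose u n := (U n)%:Q; pose v n := (V n)%:Q.
have hL : lucas_pair p%:Q q%:Q u v.
  have [U0 U1 hU'] := hU; have [V0 V1 hV'] := hV.
  rewrite /u /v; split; rewrite ?U0 ?U1 ?V0 ?V1 //.
  split=> k; rewrite -!rmorphM -rmorphB; congr (_%:~R); first exact: hU'.
  exact: hV'.
have q0 := sqr1_neq0 q2.
have [u0 u1 v0 v1 [hu hv]] := hL.
have U20 : u 2 != 0.
  by rewrite (@recurrent_at _ _ _ u 2 1 0 hu) // u0 u1 mulr0 subr0 mulr1.
have V20 : v 2 != 0.
  rewrite (@recurrent_at _ _ _ v 2 1 0 hv) // v0 v1.
  rewrite (_ : _ - _ = (p ^+ 2 - 2 * q)%:Q); last first.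
    by rewrite rmorphB rmorphXn rmorphM /=; ring.
  by rewrite intr_eq0 lucas_V2_neq0.
have mulUU x y : (discr p q)%:Q * (u x * u y)
    = v (x + y) + (-1) * (q%:Q ^ x * v (y - x)).
  rewrite discrQ mulrCA -(companionV _ q0 hL) (mulU_companion _ _ q0 hL hv).
  by rewrite mulN1r.
have mulVV x y : v x * v y = v (x + y) + 1 * (q%:Q ^ x * v (y - x)).
  by rewrite mul1r (mulV_recurrent _ _ q0 hL hv).
have mulUV x y : u x * v y = u (x + y) + (-1) * (q%:Q ^ x * u (y - x)).
  by rewrite -(companionU q0 hL) (mulU_companion _ _ q0 hL hu) mulN1r.
have sumP f eps C : recurrent p%:Q q%:Q C ->
    (forall x y, f x y = C (x + y) + eps * (q%:Q ^ x * C (y - x))) ->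
    \sum_(0 <= i < n.+1) f (r + 2 * i%:Z) (s + 2 * i%:Z)
      = a_ U (n%:Z + 1) * C (2 * n%:Z + r + s)
        + eps * (n%:R + 1) * (q%:Q ^ r * C (s - r)).
  move=> hC hf; have := sum_product (fun=> 1) r s n.+1 q2 hf.
  under eq_bigr do rewrite mul1r.
  under [X in _ = X + _]eq_bigr do rewrite mul1r.
  move=> ->; rewrite (sum_step4 _ _ q2 D0 U20 hL hC) (addrA _ r s).
  by rewrite sumr_const_nat subn0 -(natr1 n).
have altP f eps C m : recurrent p%:Q q%:Q C ->
    (forall x y, f x y = C (x + y) + eps * (q%:Q ^ x * C (y - x))) ->
    (n = (2 * m)%N ->
     \sum_(0 <= i < n.+1) (-1) ^+ i * f (r + 2 * i%:Z) (s + 2 * i%:Z)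
       = d_ V m%:Z * C (4 * m%:Z + r + s) + eps * (q%:Q ^ r * C (s - r)))
    /\
    (n = (2 * m + 1)%N ->
     \sum_(0 <= i < n.+1) (-1) ^+ i * f (r + 2 * i%:Z) (s + 2 * i%:Z)
       = - p%:Q * c_ U m%:Z * companion q%:Q C (4 * m%:Z + r + s + 2)).
  move=> hC hf; split=> ->; rewrite (sum_product _ r s _ q2 hf) sum_signs.
    rewrite (alt_sum_step4_even _ _ q2 V20 hL hC) (addrA _ r s).
    by rewrite oddM /= mulr1.
  rewrite (alt_sum_step4_odd _ _ q2 p0 V20 hL hC) (addrA _ r s).
  by rewrite addn1 oddS oddM /= mulr0 mul0r addr0.
split; first by rewrite mulr_sumr (sumP _ _ _ hv mulUU) mulN1r mulNr -mulrA.
split; first by rewrite (sumP _ _ _ hv mulVV) mul1r mulrA.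
split; first by rewrite (sumP _ _ _ hu mulUV) mulN1r mulNr mulrA.
split=> [m|].
  have [he ho] := altP _ _ _ m hv mulUU.
  rewrite mulr_sumr; under eq_bigr do rewrite -mulrA mulrCA.
  split=> hn; first by rewrite he // mulN1r.
  by rewrite ho // (companionV _ q0 hL) discrQ; ring.
split=> m.
  have [he ho] := altP _ _ _ m hv mulVV.
  under eq_bigr do rewrite -mulrA.
  split=> hn; first by rewrite he // mul1r.
  by rewrite ho // (companionV _ q0 hL) discrQ; ring.
have [he ho] := altP _ _ _ m hu mulUV.
under eq_bigr do rewrite -mulrA.
split=> hn; first by rewrite he // mulN1r.
by rewrite ho // (companionU q0 hL).
Qed.
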